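(* Consider the normal linear regression model $$y_i=\mathbf{x}_i^\top\beta+\epsilon_i,\qquad i=1,\dots,n,$$ where $\mathbf{x}_i\in\mathbb{R}^p$ are vectors of covariates, $\beta\in\mathbb{R}^p$ is the vector of regression coefficients, and $\epsilon_1,\dots,\epsilon_n$ are i.i.d. $N(0,\sigma^2)$ with $\sigma>0$, together with the Wasserstein prior $\pi_W(\beta,\sigma)\propto 1$ on $\mathbb{R}^p\times(0,\infty)$. Let $\mathbf{X}=(\mathbf{x}_1,\dots,\mathbf{x}_n)^\top$ be the design matrix and $\mathbf{y}=(y_1,\dots,y_n)^\top$ the vector of responses. Suppose that $\mathbf{X}$ has full column rank and that $\mathbf{y}$ is not in the column space of $\mathbf{X}$. Then the posterior distribution of $(\beta,\sigma)$ is proper if $n>p+1$.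
   Context: The Wasserstein prior for this model is the improper flat prior $\pi_W(\beta,\sigma)\propto 1$. The posterior distribution is called proper if the marginal likelihood (normalising constant) $$\int_0^\infty\int_{\mathbb{R}^p}\frac{1}{(2\pi)^{n/2}\sigma^n}\exp\left\{-\frac{1}{2\sigma^2}(\mathbf{y}-\mathbf{X}\beta)^\top(\mathbf{y}-\mathbf{X}\beta)\right\}d\beta\,d\sigma$$ is finite. *)

(* Defs.v *)
From HB Require Import structures.
From mathcomp Require Import all_boot all_order all_algebra.
From mathcomp Require Import all_classical all_reals all_analysis.
From mathcomp Require Import ring.
Import Order.TTheory GRing.Theory Num.Theory numFieldNormedType.Exports.

Set Implicit Arguments.
Unset Strict Implicit.
Unset Printing Implicit Defensive.

Local Open Scope classical_set_scope.
Local Open Scope ring_scope.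

Section lebesgue_tuple.
Context {R : realType}.
Local Notation T := (measurableTypeR R).
Local Open Scope ereal_scope.

Definition tuple_cons (p : nat) (z : T * p.-tuple T) : p.+1.-tuple T :=
  [tuple of z.1 :: z.2].

Lemma measurable_tuple_cons p : measurable_fun setT (@tuple_cons p).
Proof. exact: measurable_cons. Qed.

(* p-dimensional Lebesgue measure, on the product sigma-algebra of R^p
   (realized as p.-tuple R): the p-fold product of [lebesgue_measure], with
   R^(p+1) identified with R * R^p. *)
Fixpoint lebesgue_tuple (p : nat) : set (p.-tuple T) -> \bar R :=
  match p with
  | 0 => \d_ ([tuple] : 0.-tuple T)
  | p'.+1 => pushforward (lebesgue_measure \x @lebesgue_tuple p') (@tuple_cons p')
  end.

Let is_sfinite p : exists m : {sigma_finite_measure set (p.-tuple T) -> \bar R},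
  (m : set (p.-tuple T) -> \bar R) = @lebesgue_tuple p.
Proof.
elim: p => [|p [m /= <-]]; first by exists \d_ ([tuple] : 0.-tuple T).
have mc := @measurable_tuple_cons p.
pose mu0 : {measure set (p.+1.-tuple T) -> \bar R} :=
  pushforward (lebesgue_measure \x m) (@tuple_cons p).
pose mu := mu0 mc.
have sf : sigma_finite setT mu.
  have /sigma_finiteP[F [FT ndF Foo]] := sigma_finiteT (@lebesgue_measure R).
  have /sigma_finiteP[G [GT ndG Goo]] := sigma_finiteT m.
  pose h (t : p.+1.-tuple T) : T * p.-tuple T := (thead t, [tuple of behead t]).
  have mh : measurable_fun setT h.
    apply: measurable_fun_pair; last exact: measurable_behead.
    exact: measurable_tnth.
  have hK (z : T * p.-tuple T) : h (tuple_cons z) = z.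
    by case: z => a t; rewrite /h; congr pair; apply: val_inj.
  exists (fun n => h @^-1` (F n `*` G n)).
    rewrite -preimage_bigcup (_ : \bigcup_n _ = setT) ?preimage_setT//.
    rewrite -subTset -setXTT FT GT => -[x t] [/= [i _ Fx] [j _ Gt]].
    exists (maxn i j) => //; split => /=.
    - by move: x Fx; exact/subsetPset/ndF/leq_maxl.
    - by move: t Gt; exact/subsetPset/ndG/leq_maxr.
  move=> k; have [mF Fk] := Foo k; have [mG Gk] := Goo k.
  have mFG : measurable (F k `*` G k) by exact: measurableX.
  split; first by rewrite -[X in measurable X]setTI; exact: mh.
  rewrite /mu/= /pushforward -comp_preimage.
  rewrite (_ : h \o _ = id); last by apply/funext => z /=; rewrite hK.
  by rewrite preimage_id product_measure1E// lte_mul_pinfty// ge0_fin_numE.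
pose mx := Measure_isSigmaFinite.Build _ _ _ mu sf.
pose mu' : {sigma_finite_measure set (p.+1.-tuple T) -> \bar R} :=
  HB.pack (Measure.sort mu) (Measure.class mu) mx.
by exists mu'.
Qed.

Section instance.
Variable p : nat.

Let lt0 : @lebesgue_tuple p set0 = 0.
Proof. by have [m <-] := is_sfinite p; exact: measure0. Qed.

Let lt_ge0 A : 0 <= @lebesgue_tuple p A.
Proof. by have [m <-] := is_sfinite p; exact: measure_ge0. Qed.

Let lt_sigma_additive : semi_sigma_additive (@lebesgue_tuple p).
Proof.
by have [m <-] := is_sfinite p; exact: measure_semi_sigma_additive.
Qed.

HB.instance Definition _ := isMeasure.Build _ _ _ (@lebesgue_tuple p)
  lt0 lt_ge0 lt_sigma_additive.

Let lt_sigma_finite : sigma_finite setT (@lebesgue_tuple p).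
Proof. by have [m <-] := is_sfinite p; exact: sigma_finiteT. Qed.

HB.instance Definition _ := Measure_isSigmaFinite.Build _ _ _
  (@lebesgue_tuple p) lt_sigma_finite.

End instance.

Lemma lebesgue_tuple_box p (A : 'I_p -> set T) :
  (forall i, measurable (A i)) ->
  @lebesgue_tuple p [set t | forall i, A i (tnth t i)] =
  \prod_(i < p) lebesgue_measure (A i).
Proof.
elim: p A => [|p IH] A mA.
  by rewrite big_ord0 /= diracE mem_set// => -[].
rewrite big_ord_recl -IH//= /pushforward.
rewrite (_ : _ @^-1` _ =
    A ord0 `*` [set t | forall i, A (lift ord0 i) (tnth t i)]); last first.
  apply/seteqP; split=> -[a t] /= => [H|[H0 H] i].
    split; first by have := H ord0.
    by move=> i; have := H (lift ord0 i); rewrite /tuple_cons tnthS.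
  by case: (unliftP ord0 i) => [j ->|->]; rewrite /tuple_cons ?tnthS//; exact: H.
rewrite product_measure1E//.
rewrite (_ : mkset _ = \bigcap_(i in [set: 'I_p])
    ((fun t => tnth t i) @^-1` A (lift ord0 i))).
  apply: fin_bigcap_measurable => // i _.
  by rewrite -[X in measurable X]setTI; exact: measurable_tnth.
by apply/seteqP; split=> t /= H i; [move=> _|]; exact: H.
Qed.

End lebesgue_tuple.

Section regression.
Context {R : realType} {n p : nat}.
Implicit Types (X : 'M[R]_(n, p)) (y : 'cV[R]_n) (b : 'cV[R]_p) (s : R).

(* Density at y of the sample y_i = x_i^T b + e_i with e_i i.i.d. N(0, s^2),
   x_i^T being the i-th row of X. *)
Definition likelihood X y b s : R :=
  ((2 * pi) `^ (n%:R / 2) * s ^+ n)^-1 *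
  expR (- (2 * s ^+ 2)^-1 * ((y - X *m b)^T *m (y - X *m b)) 0 0).

Lemma likelihood_normal_pdf X y b s : 0 < s ->
  likelihood X y b s = \prod_(i < n) normal_pdf ((X *m b) i 0) s (y i 0).
Proof.
move=> s0; rewrite /likelihood.
under eq_bigr do rewrite normal_pdfE ?gt_eqF//.
rewrite big_split/= prodr_const card_ord -expR_sum; congr (_ * expR _).
  rewrite /normal_peak exprVn; congr (_ ^-1).
  have pi2 : 0 <= 2 * pi :> R by rewrite mulr_ge0// pi_ge0.
  rewrite [n%:R / 2]mulrC powRrM powR_mulrn ?powR_ge0//.
  rewrite (_ : s ^+ 2 * pi *+ 2 = 2 * pi * s ^+ 2); last by ring.
  by rewrite sqrtrM// sqrtr_sqr gtr0_norm// exprMn powR12_sqrt.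
rewrite mxE mulr_sumr; apply: eq_bigr => i _; rewrite !mxE.
by field; rewrite gt_eqF.
Qed.

(* Improper flat prior on R^p * (0, +oo): the normalization pi_W = 1 of
   pi_W \propto 1. *)
Definition wasserstein_prior b s : R := 1.

(* The integrand is nonnegative when [prior] is, so that the integral is the
   Lebesgue integral with values in [0, +oo]. *)
Definition marginal_likelihood (prior : 'cV[R]_p -> R -> R) X y : \bar R :=
  (\int[lebesgue_measure]_(s in `]0%R, +oo[)
    \int[@lebesgue_tuple R p]_t
      (let b := \col_i tnth t i in (prior b s * likelihood X y b s)%:E))%E.

Definition posterior_proper prior X y : Prop :=
  marginal_likelihood prior X y \is a fin_num.

End regression.

(* Main.v *)
Require Import Defs.
From mathcomp Require Import all_boot all_order all_algebra.
From mathcomp Require Import all_classical all_reals all_analysis.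
From mathcomp Require Import measurable_realfun ring.
Import Order.TTheory GRing.Theory Num.Theory.

Set Implicit Arguments.
Unset Strict Implicit.
Unset Printing Implicit Defensive.

Local Open Scope ring_scope.

(* The columns of [X] together with [y] are linearly independent, so
   [|y - X b|^2 >= r^2 (1 + |b|^2)] for some [r > 0]. Hence the likelihood at
   [s] is at most [s^-n exp(- r^2 / (2 s^2))] times a product of centered
   Gaussian factors of standard deviation [s / r], whose integral over [b] is a
   constant times [s^p]. What remains is [s^-m exp(- r^2 / (2 s^2))] with
   [m = n - p >= 2], which is dominated by a multiple of [(1 + s^2)^-1]. *)

(* The integral of a nonnegative function is a supremum over the simple
   functions below it, so monotonicity needs no measurability. *)
Lemma ge0_nonmeasurable_le_integral d (T : measurableType d) (R : realType)
    (mu : {measure set T -> \bar R}) (D : set T) (f g : T -> \bar R) :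
  (forall x, D x -> 0 <= f x)%E -> (forall x, D x -> f x <= g x)%E ->
  (\int[mu]_(x in D) f x <= \int[mu]_(x in D) g x)%E.
Proof.
move=> f0 fg; rewrite !ge0_integralE//; last first.
  by move=> x Dx; exact: le_trans (f0 _ Dx) (fg _ Dx).
apply: ereal_sup_le => _ /= [h hf <-]; exists h => // x.
by apply: le_trans (hf x) _; exact: lee_restrict.
Qed.

Section gaussian_tail.
Context {R : realType}.
Implicit Types a s : R.

(** For [N > 0], take the [N]-th power of [1 + x <= expR x] at [x = a * t ^+ 2 / N]. *)
Lemma expR_ge_oneDsqr a N : 0 < a ->
  exists2 c : R, 0 < c & forall t : R, c * (1 + t ^+ 2) ^+ N <= expR (a * t ^+ 2).
Proof.
move=> a0; case: N => [|N].
  exists 1 => // t; rewrite expr0 mulr1 -[leLHS]expR0 ler_expR.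
  by rewrite mulr_ge0 ?sqr_ge0// ltW.
(* The minimum makes [c * (1 + t ^+ 2)] at most [1 + a / N.+1%:R * t ^+ 2], term by term. *)
pose c := Num.min 1 (a / N.+1%:R).
have c0 : 0 < c by rewrite lt_min ltr01 divr_gt0.
exists (c ^+ N.+1) => [|t]; first by rewrite exprn_gt0.
have -> : a * t ^+ 2 = (a / N.+1%:R * t ^+ 2) * N.+1%:R.
  by rewrite mulrAC divfK ?pnatr_eq0.
rewrite expRM_natr -exprMn lerXn2r ?nnegrE ?expR_ge0//.
  by rewrite mulr_ge0 ?(ltW c0)// addr_ge0 ?sqr_ge0.
apply: le_trans (expR_ge1Dx _); rewrite mulrDr mulr1 lerD ?ge_min ?lexx//.
by rewrite ler_wpM2r ?sqr_ge0// ge_min lexx orbT.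
Qed.

(** The substitution [t = s^-1] turns the singularity at [0] into growth at infinity. With
    [m = k.+2], the power [k.+1] leaves one factor [1 + s ^+ 2] to keep and [k] factors to play
    against [s ^+ k]. *)
Lemma exprVn_expRN_le a m : 0 < a -> (1 < m)%N ->
  exists2 K : R, 0 < K &
    forall s, 0 < s -> (s ^+ m)^-1 * expR (- (a / s ^+ 2)) <= K * (1 + s ^+ 2)^-1.
Proof.
case: m => [|[|k]]// a0 _.
have [c c0 cP] := expR_ge_oneDsqr k.+1 a0.
exists c^-1 => [|s s0]; first by rewrite invr_gt0.
have d0 : 0 < 1 + s ^+ 2 by rewrite ltr_wpDr ?sqr_ge0.
have sm0 : 0 < s ^+ k.+2 by exact: exprn_gt0.
rewrite expRN -!invfM lef_pV2 ?posrE ?(mulr_gt0 sm0) ?mulr_gt0 ?expR_gt0//.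
have := cP s^-1; rewrite exprVn.
have -> : 1 + (s ^+ 2)^-1 = (1 + s ^+ 2) / s ^+ 2 by field; rewrite gt_eqF.
move=> h; apply: le_trans (ler_wpM2l (ltW sm0) h).
(* This reduces to [s <= 1 + s ^+ 2], by completing the square. *)
have sk : s ^+ k <= (1 + s ^+ 2) ^+ k.
  apply: lerXn2r; rewrite ?nnegrE ?(ltW s0) ?(ltW d0)//.
  rewrite -subr_ge0 (_ : _ - _ = (s - 2^-1) ^+ 2 + 3 / 4); last by field.
  by rewrite addr_ge0 ?sqr_ge0.
have -> : s ^+ k.+2 * (c * ((1 + s ^+ 2) / s ^+ 2) ^+ k.+1) =
    c * (1 + s ^+ 2) * ((1 + s ^+ 2) ^+ k / s ^+ k).
  rewrite expr_div_n -exprM mulnC muln2 -addnn addSn addnS !exprS exprD.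
  by field; rewrite ?expf_neq0 ?gt_eqF.
by rewrite ler_peMr ?mulr_ge0 ?(ltW c0) ?(ltW d0)// ler_pdivlMr ?exprn_gt0// mul1r.
Qed.

End gaussian_tail.

Section row_free_bound.
Context {R : realType}.

Lemma sqr_mulmx_le n m (L : 'M[R]_(n, m)) :
  exists2 C : R, 0 < C & forall v : 'rV[R]_n,
    \sum_j (v *m L) 0 j ^+ 2 <= C * \sum_i v 0 i ^+ 2.
Proof.
(* Every entry of [v] is at most its Euclidean norm, so column [j] of [L] contributes the square of
   its absolute sum. The added [1] only keeps the constant positive. *)
exists (1 + \sum_j (\sum_i `|L i j|) ^+ 2) => [|v].
  by rewrite ltr_wpDr// sumr_ge0// => j _; rewrite sqr_ge0.
set S := \sum_i v 0 i ^+ 2.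
have S0 : 0 <= S by rewrite sumr_ge0// => i _; rewrite sqr_ge0.
have vS i : `|v 0 i| <= Num.sqrt S.
  rewrite -sqrtr_sqr ler_wsqrtr// /S (bigD1 i)//= lerDl sumr_ge0// => j _.
  by rewrite sqr_ge0.
rewrite mulrDl mul1r mulr_suml -[leLHS]add0r lerD// ler_sum// => j _.
rewrite -[X in _ <= _ * X]sqr_sqrtr// -exprMn -real_normK ?num_real//.
rewrite lerXn2r ?nnegrE ?mulr_ge0 ?sqrtr_ge0// ?sumr_ge0//.
rewrite mxE (le_trans (ler_norm_sum _ _ _))// mulr_suml ler_sum// => i _.
by rewrite normrM mulrC ler_wpM2l.
Qed.

(** A right inverse [B] recovers [u] as [u *m A *m B], and multiplication by [B] is bounded. *)
Lemma row_free_sqr_ge n m (A : 'M[R]_(m, n)) : row_free A ->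
  exists2 c : R, 0 < c & forall u : 'rV[R]_m,
    c * \sum_j u 0 j ^+ 2 <= \sum_i (u *m A) 0 i ^+ 2.
Proof.
move=> /row_freeP[B AB]; have [C C0 CP] := sqr_mulmx_le B.
exists C^-1 => [|u]; first by rewrite invr_gt0.
by rewrite mulrC ler_pdivrMr// mulrC; have := CP (u *m A); rewrite -mulmxA AB mulmx1.
Qed.

(** Adjoining [y] strictly enlarges the row space, so the rank exceeds [p]. *)
Lemma row_free_col_mx n p (X : 'M[R]_(p, n)) (y : 'rV[R]_n) :
  \rank X = p -> ~~ (y <= X)%MS -> row_free (col_mx y X).
Proof.
move=> rX yX; rewrite /row_free eqn_leq rank_leq_row/=.
have : (X < col_mx y X)%MS.
  by rewrite /ltmx -addsmxE addsmxSr col_mx_sub negb_and yX.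
by rewrite ltmxErank rX => /andP[].
Qed.

(** The transposed residual is the row [(1, - b^T)] times the matrix with rows [y^T] and [X^T], and
    that row has squared norm [1 + |b|^2]. *)
Lemma residual_ge n p (X : 'M[R]_(n, p)) (y : 'cV[R]_n) :
  \rank X = p -> ~~ (y^T <= X^T)%MS ->
  exists2 r : R, 0 < r & forall b : 'cV[R]_p,
    r ^+ 2 * (1 + \sum_i b i 0 ^+ 2) <= ((y - X *m b)^T *m (y - X *m b)) 0 0.
Proof.
rewrite -mxrank_tr => rX yX.
have [c c0 cP] := row_free_sqr_ge (row_free_col_mx rX yX).
exists (Num.sqrt c) => [|b]; first by rewrite sqrtr_gt0.
have := cP (row_mx 1%:M (- b^T)).
rewrite mul_row_col mul1mx mulNmx -trmx_mul -linearB/= sqr_sqrtr ?(ltW c0)//.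
congr (_ * _ <= _).
  rewrite big_split_ord/= big_ord1 row_mxEl mxE eqxx expr1n; congr (_ + _).
  by apply: eq_bigr => i _; rewrite row_mxEr !mxE sqrrN.
by rewrite mxE; apply: eq_bigr => i _; rewrite [in LHS]mxE expr2 [in RHS]mxE.
Qed.

End row_free_bound.

Section product_integral.
Context {R : realType}.
Local Notation T := (measurableTypeR R).

(** Induction on [p]: change variables along [tuple_cons], then split off the first coordinate by
    Tonelli. *)
Lemma integral_lebesgue_tuple_prod p (f : T -> R) :
  measurable_fun setT f -> (forall x, 0 <= f x) ->
  (\int[lebesgue_measure]_x (f x)%:E = 1)%E ->
  (\int[@lebesgue_tuple R p]_t (\prod_(i < p) f (tnth t i))%:E = 1)%E.
Proof.
move=> mf f0 f1; elim: p => [|p IH].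
  rewrite (eq_measure_integral (\d_ ([tuple] : 0.-tuple T)))//.
  under eq_integral do rewrite big_ord0.
  by rewrite integral_cst// mul1e /= diracT.
under eq_integral do rewrite big_ord_recl EFinM.
pose g (t : p.-tuple T) := \prod_(i < p) f (tnth t i).
have mg : measurable_fun setT g.
  apply: measurable_prod => i _; apply: measurableT_comp => //.
  exact: measurable_tnth.
have g0 t : 0 <= g t by exact: prodr_ge0.
pose F (t : p.+1.-tuple T) := (f (thead t) * g [tuple of behead t])%:E.
rewrite (eq_measure_integral
  (pushforward (lebesgue_measure \x @lebesgue_tuple R p)%E (@tuple_cons R p)))//; first exact: measurable_tuple_cons.
(* [F] separates head from tail, so that its pullback along [tuple_cons] is a product of functions
   of the two coordinates. *)
move=> mcons; rewrite (eq_integral F); last first.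
  move=> t _; rewrite -EFinM /F; congr (_ * _)%:E.
  by apply: eq_bigr => i _; rewrite [in LHS](tuple_eta t) tnthS.
rewrite (ge0_integral_pushforward (@measurable_tuple_cons R p))//; last 2 first.
- apply/measurable_EFinP/measurable_funM.
    by apply: measurableT_comp => //; exact: measurable_tnth.
  by apply: measurableT_comp => //; exact: measurable_behead.
- by move=> t _; rewrite lee_fin mulr_ge0.
rewrite preimage_setT (eq_integral (fun z => (f z.1 * g z.2)%:E)); last first.
  move=> [a t] _ /=; congr (_ * _)%:E; congr (g _).
  exact: val_inj.
rewrite fubini_tonelli1//=; last 2 first.
- apply/measurable_EFinP/measurable_funM; first exact: measurableT_comp.
  exact: measurableT_comp.
- by move=> z; rewrite lee_fin mulr_ge0.
rewrite /fubini_F/= -[RHS]f1; apply: eq_integral => x _.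
under eq_integral do rewrite EFinM.
rewrite ge0_integralZl_EFin//; first by rewrite IH mule1.
- by move=> t _; rewrite lee_fin.
- exact/measurable_EFinP.
Qed.

End product_integral.

Section likelihood.
Context {R : realType} {n p : nat}.

Lemma likelihood_le (X : 'M[R]_(n, p)) (y : 'cV[R]_n) (b : 'cV[R]_p) (r s : R) :
  0 < r -> 0 < s ->
  r ^+ 2 * (1 + \sum_i b i 0 ^+ 2) <= ((y - X *m b)^T *m (y - X *m b)) 0 0 ->
  (p <= n)%N ->
  likelihood X y b s <=
  ((2 * pi) `^ (n%:R / 2))^-1 * (Num.sqrt (pi *+ 2) / r) ^+ p *
  ((s ^+ (n - p))^-1 * expR (- (r ^+ 2 / 2 / s ^+ 2))) *
  \prod_i normal_pdf 0 (s / r) (b i 0).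
Proof.
move=> r0 s0 hr pn.
have sr0 : 0 < s / r by rewrite divr_gt0.
set q := Num.sqrt (pi *+ 2).
have q0 : 0 < q by rewrite sqrtr_gt0 mulrn_wgt0// pi_gt0.
have peakE : normal_peak (s / r) = (s / r * q)^-1.
  by rewrite /normal_peak -mulrnAr sqrtrM ?sqr_ge0// sqrtr_sqr gtr0_norm.
under eq_bigr do rewrite normal_pdfE ?gt_eqF//.
rewrite big_split/= prodr_const card_ord peakE -expR_sum.
rewrite /likelihood invfM -[leRHS]mulrA -[leRHS]mulrA -[leLHS]mulrA.
rewrite ler_wpM2l ?invr_ge0 ?powR_ge0//.
(* The constant [(q / r) ^+ p] cancels all of the Gaussian normalisation except [s^-1 ^+ p];
   together with the exponent [n - p] this restores [s^-1 ^+ n]. *)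
have -> x w z : (q / r) ^+ p * (x * w * ((s / r * q)^-1 ^+ p * z)) =
    s^-1 ^+ p * x * (w * z).
  have -> : s^-1 = q / r * (s / r * q)^-1 by field; rewrite ?gt_eqF.
  by rewrite [in RHS]exprMn; ring.
rewrite -!exprVn -exprD addnC subnK// exprVn -expRD.
rewrite ler_wpM2l ?invr_ge0 ?exprn_ge0 ?(ltW s0)// ler_expR.
rewrite [leRHS](_ : _ =
  - (2 * s ^+ 2)^-1 * (r ^+ 2 * (1 + \sum_i b i 0 ^+ 2))); last first.
  rewrite [RHS]mulrA [RHS]mulrDr mulr1 [in RHS]mulr_sumr; congr (_ + _).
    by field; rewrite gt_eqF.
  by apply: eq_bigr => i _; rewrite subr0; field; rewrite ?gt_eqF.
by rewrite ler_wnM2l// oppr_le0 invr_ge0 mulr_ge0 ?sqr_ge0.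
Qed.

End likelihood.

Theorem theorem6 (R : realType) (n p : nat) (X : 'M[R]_(n, p)) (y : 'cV[R]_n) :
  \rank X = p ->
  ~~ (y^T <= X^T)%MS ->
  (p.+1 < n)%N ->
  posterior_proper (@wasserstein_prior R p) X y.
Proof.
move=> rX yX pn.
have [r r0 hr] := residual_ge rX yX.
have a0 : 0 < r ^+ 2 / 2 by rewrite divr_gt0 ?exprn_gt0.
have m1 : (1 < n - p)%N by rewrite ltn_subRL addn1.
have [K K0 hK] := exprVn_expRN_le a0 m1.
set c := ((2 * pi) `^ (n%:R / 2))^-1 * (Num.sqrt (pi *+ 2) / r) ^+ p : R.
have c0 : 0 <= c.
  by rewrite mulr_ge0 ?invr_ge0 ?powR_ge0// exprn_ge0// divr_ge0 ?sqrtr_ge0// ltW.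
have L0 s b : 0 < s -> 0 <= wasserstein_prior b s * likelihood X y b s.
  move=> s0; rewrite mul1r mulr_ge0 ?expR_ge0// invr_ge0 mulr_ge0 ?powR_ge0//.
  by rewrite exprn_ge0// ltW.
have V0 (s : R) : 0 <= (oneDsqr s)^-1 by rewrite invr_ge0 (le_trans ler01)// oneDsqr_ge1.
have inner s : 0 < s ->
    (\int[@lebesgue_tuple R p]_t (wasserstein_prior (\col_i tnth t i) s *
       likelihood X y (\col_i tnth t i) s)%:E <=
     (c * K)%:E * (oneDsqr s)^-1%:E)%E.
  move=> s0; pose d := c * K * (oneDsqr s)^-1.
  have d0 : 0 <= d by rewrite (mulr_ge0 _ (V0 s))// mulr_ge0// ltW.
  pose f := normal_pdf 0 (s / r).
  have f0 x : 0 <= f x by exact: normal_pdf_ge0.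
  have mf : measurable_fun setT f by exact: measurable_normal_pdf.
  rewrite -EFinM -/d -[leRHS]mule1.
  (* The factor [1] becomes the integral of the Gaussian product, which reduces the claim to a
     pointwise bound on integrands. *)
  rewrite -(integral_lebesgue_tuple_prod p mf f0 (integral_normal_pdf _ _)).
  rewrite -ge0_integralZl_EFin//; last 2 first.
  - by move=> t _; rewrite lee_fin prodr_ge0.
  - apply/measurable_EFinP/measurable_prod => i _; apply: measurableT_comp => //.
    exact: measurable_tnth.
  apply: ge0_nonmeasurable_le_integral => t _; first by rewrite lee_fin L0.
  rewrite -EFinM lee_fin mul1r.
  apply: le_trans (likelihood_le r0 s0 (hr _) (ltnW (ltnW pn))) _.
  under eq_bigr do rewrite mxE.
  apply: ler_wpM2r; first exact: prodr_ge0.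
  by rewrite /d -(mulrA c K); apply: ler_wpM2l c0 _ _ _; exact: hK.
rewrite /posterior_proper /marginal_likelihood ge0_fin_numE; last first.
  apply: integral_ge0 => s /=; rewrite in_itv/= andbT => s0.
  by apply: integral_ge0 => t _; rewrite lee_fin L0.
have mq : measurable_fun setT (fun s : R => (oneDsqr s)^-1%:E).
  apply/measurable_EFinP.
  exact: (continuous_measurable_fun (@continuous_oneDsqrV R)).
apply: (@le_lt_trans _ _
    (\int[lebesgue_measure]_(s in `]0%R, +oo[) ((c * K)%:E * (oneDsqr s)^-1%:E))%E).
  apply: ge0_nonmeasurable_le_integral => s /=; rewrite in_itv/= andbT => s0.
    by apply: integral_ge0 => t _; rewrite lee_fin L0.
  exact: inner.
rewrite ge0_integralZl_EFin//; last 2 first.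
- exact: measurable_funTS.
- by rewrite mulr_ge0// ltW.
apply: lte_mul_pinfty => //; first by rewrite lee_fin mulr_ge0// ltW.
(* Closing the interval at [0] gives the half-line on which the integral of [(oneDsqr s)^-1] has a
   known finite value. *)
apply: (@le_lt_trans _ _
    (\int[lebesgue_measure]_(s in `[0%R, +oo[) (oneDsqr s)^-1%:E)%E).
  apply: ge0_subset_integral => //.
  - exact: measurable_funTS.
  - by apply: subset_itvr; rewrite bnd_simp.
by rewrite integral0y_oneDsqr ltry.
Qed.
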